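(* Let $d\ge 1$, let $\mathcal{O}=\{t_1,\dots,t_\mu\}$ be the simplicial order ideal of type $d$ in $\mathbb{T}^n$, and let $s=\#C^{\rm int}=\#\mathcal{O}^{\rm int}\cdot\#(\partial\mathcal{O})=\binom{d+n-1}{n}\cdot\binom{d+n}{n-1}$. (a) There exists a term ordering $\sigma$ such that for each indeterminate $c_{ij}\in C^{\rm int}$ there is a natural generator $f_{ij}$ of $I(\mathbb{B}_{\mathcal{O}})$ with $c_{ij}=\mathrm{LT}_\sigma(f_{ij})$. (b) Using $Z=C^{\rm int}$, the tuple $F=(f_{ij})$ is $Z$-separating and consists of natural generators of $I(\mathbb{B}_{\mathcal{O}})$.
   Context: $K$ is a field, and $\mathbb{T}^n$ is the set of terms (power products) in the indeterminates $x_1,\dots,x_n$ of $P=K[x_1,\dots,x_n]$. The simplicial order ideal of type $d\ge1$ is $\mathcal{O}=\{t\in\mathbb{T}^n\mid\deg(t)\le d\}$. Its border is $\partial\mathcal{O}=(x_1\mathcal{O}\cup\dots\cup x_n\mathcal{O})\setminus\mathcal{O}=\{b_1,\dots,b_\nu\}$. A term $t_i\in\mathcal{O}$ is a rim term if $x_kt_i\in\partial\mathcal{O}$ for some $k$, and an interior term otherwise; $\mathcal{O}^{\rm int}$ is the set of interior terms. Let $c_{ij}$ ($1\le i\le\mu$, $1\le j\le\nu$) be indeterminates, $C=(c_{ij})$, $K[C]=K[c_{11},\dots,c_{\mu\nu}]$; $C^{\rm int}$ consists of the $c_{ij}$ with $t_i\in\mathcal{O}^{\rm int}$. The generic multiplication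 matrix $\mathcal{A}_r\in\mathrm{Mat}_\mu(K[C])$ ($r=1,\dots,n$) has $(i,j)$ entry $\delta_{im}$ if $x_rt_j=t_m\in\mathcal{O}$ and $c_{im}$ if $x_rt_j=b_m\in\partial\mathcal{O}$. $I(\mathbb{B}_{\mathcal{O}})\subseteq K[C]$ is the ideal generated by the entries of all commutators $\mathcal{A}_k\mathcal{A}_\ell-\mathcal{A}_\ell\mathcal{A}_k$ with $1\le k<\ell\le n$. Natural generators of $I(\mathbb{B}_{\mathcal{O}})$: write $\mathbf{c}_j=(c_{1j},\dots,c_{\mu j})^{\rm tr}$. For next-door neighbors $b_j=x_kb_{j'}$, take the entries of $\mathbf{c}_j-\mathcal{A}_k\mathbf{c}_{j'}$; for across-the-rim neighbors $b_j=x_kt_m$, $b_{j'}=x_\ell t_m$ ($k\ne\ell$, $t_m\in\mathcal{O}$), take the entries of $\mathcal{A}_\ell\mathbf{c}_j-\mathcal{A}_k\mathbf{c}_{j'}$ (everything up to sign). They generate $I(\mathbb{B}_{\mathcal{O}})$. $\mathrm{LT}_\sigma$ denotes the leading term with respect to $\sigma$. A tuple of polynomials $(f_1,\dots,f_s)$ in $K[C]$ is $Z$-separating for a tuple $Z=(z_1,\dots,z_s)$ of distinct indeterminates in $C$ if there is a term ordering $\sigma$ with $\mathrm{LT}_\sigma(f_i)=z_i$ for all $i$.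
   Formalization: The number of indeterminates n is assumed to be at least 2; for n = 1 the border has one term, so there are no natural generators while C^int has d ≥ 1 elements, and (a) fails. *)

(* Defs.v *)
From HB Require Import structures.
From mathcomp Require Import all_boot all_order all_algebra.
From mathcomp Require Import finmap.
From mathcomp Require Export mpoly.

Set Implicit Arguments.
Unset Strict Implicit.
Unset Printing Implicit Defensive.

Import GRing.Theory.
Local Open Scope ring_scope.
Local Open Scope fset_scope.

(* A term of T^n is its exponent vector in 'X_{1..n}: the product of terms is
   the addition (_ + _)%MM, the term 1 is 0%MM, and x_k is U_(k)%MM. *)

Section Terms.
Context {n : nat}.
Implicit Types (O : {fset 'X_{1..n}}) (t b : 'X_{1..n}).

Definition order_ideal O : Prop :=
  forall k t, (U_(k) + t)%MM \in O -> t \in O.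

Definition border O : {fset 'X_{1..n}} :=
  (\bigcup_(k in 'I_n) [fset (U_(k) + t)%MM | t in O]) `\` O.

Definition rim O : {fset 'X_{1..n}} :=
  [fset t in O | [exists k, (U_(k) + t)%MM \in border O]].

Definition interior O : {fset 'X_{1..n}} := O `\` rim O.

(* The enumeration t_1, ..., t_mu of O. *)
Definition term_at O (i : 'I_#|` O|) : 'X_{1..n} := tnth (in_tuple O) i.

End Terms.

Arguments term_at {n} O i.

Definition simplicial (n d : nat) : {fset 'X_{1..n}} :=
  [fset bmnm t | t in {: 'X_{1..n < d.+1}}].

Lemma in_simplicial n d (t : 'X_{1..n}) : (t \in simplicial n d) = (mdeg t <= d)%N.
Proof.
apply/imfsetP/idP => [[u _ ->]|le_td]; first by rewrite -ltnS bmdeg.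
by exists (BMultinom (le_td : (mdeg t < d.+1)%N)).
Qed.

Lemma simplicial_order_ideal n d : order_ideal (simplicial n d).
Proof.
move=> k t; rewrite !in_simplicial mdegD; exact/leq_trans/leq_addl.
Qed.

Lemma in_border n (O : {fset 'X_{1..n}}) b :
  reflect (b \notin O /\ exists k, exists2 t, t \in O & b = (U_(k) + t)%MM)
          (b \in border O).
Proof.
rewrite in_fsetD; apply: (iffP andP) => -[bO].
  case/bigfcupP => k _ /imfsetP [t /= tO eb]; split => //.
  by exists k, t.
case=> k [t tO eb]; split => //; apply/bigfcupP; exists k.
  by rewrite mem_index_enum.
by apply/imfsetP; exists t.
Qed.

Section TermOrderings.
Context {N : nat} {R : nzRingType}.
Implicit Types (sigma : rel 'X_{1..N}) (p : {mpoly R[N]}).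

(* sigma m1 m2 reads "m1 is smaller than or equal to m2". *)
Definition term_ordering sigma : Prop :=
  [/\ total sigma, antisymmetric sigma, transitive sigma,
      forall m, sigma 0%MM m
    & forall m m1 m2, sigma m1 m2 -> sigma (m + m1)%MM (m + m2)%MM].

(* The sigma-largest term in the support, without its coefficient; as for
   mlead, the default value for p = 0 is 0%MM. *)
Definition LT sigma p : 'X_{1..N} :=
  \big[(fun m1 m2 => if sigma m1 m2 then m2 else m1)/0%MM]_(m <- msupp p) m.

Definition separating s (Z : s.-tuple 'I_N) (F : s.-tuple {mpoly R[N]}) : Prop :=
  uniq Z /\
  exists2 sigma, term_ordering sigma
    & forall k : 'I_s, LT sigma (tnth F k) = U_(tnth Z k)%MM.

Lemma LTP sigma p : term_ordering sigma -> p != 0 ->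
  LT sigma p \in msupp p /\ {in msupp p, forall m, sigma m (LT sigma p)}.
Proof.
case=> tot asym trans le0 _; rewrite -msupp_eq0 /LT.
elim: (msupp p) => // m s IHs _; rewrite big_cons.
have refl u : sigma u u by have:= tot u u; rewrite orbb.
have [->|/IHs [Lin Lmax]] := eqVneq s [::].
  rewrite big_nil; have -> : (if sigma m 0%MM then 0%MM else m) = m.
    by case: ifP => // m0; apply: asym; rewrite m0 le0.
  by rewrite mem_head; split => // u; rewrite inE => /eqP ->.
case: ifP => mL.
  split; first by rewrite inE Lin orbT.
  by move=> u; rewrite inE => /predU1P [->|/Lmax].
have Lm := tot m (\big[(fun m1 m2 => if sigma m1 m2 then m2 else m1)/0%MM]_(m <- s) m).
rewrite mL /= in Lm.
split; first exact: mem_head.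
by move=> u; rewrite inE => /predU1P [->//|/Lmax uL]; apply: trans Lm.
Qed.

End TermOrderings.

Definition in_ideal (R : comNzRingType) (S : R -> Prop) (f : R) : Prop :=
  exists2 l : seq (R * R),
    (forall p, p \in l -> S p.2) & f = \sum_(p <- l) p.1 * p.2.

Section IdealTheory.
Context {R : comNzRingType}.
Implicit Types (S : R -> Prop) (f g : R).

Lemma in_ideal_gen S g : S g -> in_ideal S g.
Proof.
move=> Sg; exists [:: (1, g)]; last by rewrite big_seq1 mul1r.
by move=> p; rewrite inE => /eqP ->.
Qed.

Lemma in_ideal0 S : in_ideal S 0.
Proof. by exists [::]; rewrite ?big_nil. Qed.

Lemma in_idealD S f g : in_ideal S f -> in_ideal S g -> in_ideal S (f + g).
Proof.
case=> [l1 S1 ->] [l2 S2 ->]; exists (l1 ++ l2); last by rewrite big_cat.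
by move=> p; rewrite mem_cat => /orP [/S1|/S2].
Qed.

Lemma in_idealM S f g : in_ideal S g -> in_ideal S (f * g).
Proof.
case=> l Sl ->; exists [seq (f * p.1, p.2) | p <- l].
  by move=> _ /mapP [p /Sl Sp ->].
by rewrite big_map mulr_sumr; apply: eq_bigr => p _; rewrite mulrA.
Qed.

Lemma in_idealN S f : in_ideal S f -> in_ideal S (- f).
Proof. by rewrite -mulN1r; apply: in_idealM. Qed.

Lemma in_ideal_trans S S' f :
  (forall g, S g -> in_ideal S' g) -> in_ideal S f -> in_ideal S' f.
Proof.
move=> SS' [l Sl ->]; rewrite big_seq_cond; elim/big_rec: _ => [|p g].
  exact: in_ideal0.
by rewrite andbT => /Sl /SS' Sp; apply: in_idealD; apply: in_idealM.
Qed.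

End IdealTheory.

Section BorderBasisScheme.
Context (K : fieldType) {n : nat} (O : {fset 'X_{1..n}}).

Local Notation mu := #|` O|.
Local Notation nu := #|` border O|.
Local Notation t_ := (term_at O).
Local Notation b_ := (term_at (border O)).

(* The indeterminates c_ij of K[C] are numbered by mxvec_index i j. *)
Local Notation KC := {mpoly K[mu * nu]}.

Definition C : 'M[KC]_(mu, nu) := \matrix_(i, j) 'X_(mxvec_index i j).

(* When x_r t_j lies in O or in its border, it is t_m or b_m for exactly one
   m; it always does, so the final default 0 is never used. *)
Definition genmx (r : 'I_n) : 'M[KC]_mu :=
  \matrix_(i, j)
    if [pick m | t_ m == (U_(r) + t_ j)%MM] is Some m then (i == m)%:R
    else if [pick m | b_ m == (U_(r) + t_ j)%MM] is Some m then C i m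
    else 0.

Inductive commutator_entry : KC -> Prop :=
  CommutatorEntry (k l : 'I_n) (i j : 'I_mu) of (k < l)%N :
    commutator_entry
      ((genmx k *m genmx l - genmx l *m genmx k) i j).

Definition I_B : KC -> Prop := in_ideal commutator_entry.

(* In AcrossRim, exchanging the roles of j and j' gives the opposite
   polynomial. *)
Inductive natural_generator : KC -> Prop :=
  | NextDoor (k : 'I_n) (j j' : 'I_nu) (i : 'I_mu)
      of b_ j = (U_(k) + b_ j')%MM :
      natural_generator ((col j C - genmx k *m col j' C) i 0)
  | AcrossRim (k l : 'I_n) (m : 'I_mu) (j j' : 'I_nu) (i : 'I_mu)
      of k != l & b_ j = (U_(k) + t_ m)%MM & b_ j' = (U_(l) + t_ m)%MM :
      natural_generator ((genmx l *m col j C - genmx k *m col j' C) i 0).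

Definition C_int : {set 'I_(mu * nu)} :=
  [set mxvec_index i j | i in [pred i | t_ i \in interior O], j in 'I_nu].

Context (O_ideal : order_ideal O).

Lemma term_at_inj (P : {fset 'X_{1..n}}) : injective (term_at P).
Proof. exact/tuple_uniqP/fset_uniq. Qed.

Lemma term_atP (P : {fset 'X_{1..n}}) t :
  reflect (exists i, term_at P i = t) (t \in P).
Proof.
apply: (iffP (@tnthP _ _ (in_tuple P) t)) => -[i]; first by move->; exists i.
by move<-; exists i.
Qed.

Lemma genmx_O (r : 'I_n) (j m : 'I_mu) :
  t_ m = (U_(r) + t_ j)%MM -> col j (genmx r) = delta_mx m 0.
Proof.
move=> em; apply/colP => i; rewrite !mxE -em.
case: pickP => [m' /eqP /term_at_inj ->|/(_ m)]; last by rewrite eqxx.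
by rewrite eqxx andbT.
Qed.

Lemma genmx_border (r : 'I_n) (j : 'I_mu) (m : 'I_nu) :
  b_ m = (U_(r) + t_ j)%MM -> col j (genmx r) = col m C.
Proof.
move=> em; apply/colP => i; rewrite 2!mxE -em.
case: pickP => [m' /eqP e|_].
  have /in_border[] : b_ m \in border O by apply/term_atP; exists m.
  by rewrite -e; case/negP; apply/term_atP; exists m'.
case: pickP => [m' /eqP /term_at_inj ->|/(_ m)]; last by rewrite eqxx.
by rewrite [RHS]mxE.
Qed.

Lemma term_step (r : 'I_n) (j : 'I_mu) :
  (exists m, t_ m = (U_(r) + t_ j)%MM) \/ (exists m, b_ m = (U_(r) + t_ j)%MM).
Proof.
case tO: ((U_(r) + t_ j)%MM \in O); first by left; apply/term_atP.
right; apply/term_atP/in_border; split; first by rewrite tO.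
by exists r, (t_ j) => //; apply/term_atP; exists j.
Qed.

Lemma col_mul_genmx (k l : 'I_n) (j : 'I_mu) :
  col j (genmx k *m genmx l) = genmx k *m col j (genmx l).
Proof. by apply/colP => i; rewrite !mxE; apply: eq_bigr => p _; rewrite !mxE. Qed.

Lemma commutator_col (k l : 'I_n) (i j : 'I_mu) :
  (genmx k *m genmx l - genmx l *m genmx k) i j
  = (genmx k *m col j (genmx l) - genmx l *m col j (genmx k)) i 0.
Proof. by rewrite -!col_mul_genmx !mxE. Qed.

Lemma commutator_entry_neq (k l : 'I_n) (i j : 'I_mu) :
  k != l -> I_B ((genmx k *m genmx l - genmx l *m genmx k) i j).
Proof.
move=> kl; have [lt_kl|lt_lk|/val_inj e] := ltngtP k l.
- exact/in_ideal_gen/CommutatorEntry.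
- rewrite -opprB mxE; apply/in_idealN/in_ideal_gen.
  exact: CommutatorEntry.
- by rewrite e eqxx in kl.
Qed.

Lemma mul_genmx_delta (k : 'I_n) (m : 'I_mu) :
  genmx k *m delta_mx m 0 = col m (genmx k) :> 'cV_mu.
Proof. by rewrite colE. Qed.

Lemma genmx_target (k : 'I_n) (i j : 'I_mu) :
  t_ i = (U_(k) + t_ j)%MM -> (U_(k) + t_ j)%MM \in O.
Proof. by move=> <-; apply/term_atP; exists i. Qed.

Lemma border_notin (j : 'I_nu) : b_ j \notin O.
Proof.
by have /in_border[] : b_ j \in border O by apply/term_atP; exists j.
Qed.

Lemma natural_generator_in_I_B f : natural_generator f -> I_B f.
Proof.
case=> [k j j' i ej|k l m j j' i kl ej ej'].
  have /in_border[bO [p [t tO ep]]] : b_ j \in border O by apply/term_atP; exists j.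
  have pk : p != k.
    apply: contraNneq (border_notin j') => epk.
    have -> // : b_ j' = t.
    by apply: (@addmI _ U_(k)%MM); rewrite -ej ep epk.
  have Up : (U_(p) <= b_ j')%MM.
    rewrite lep1mP; have /mnmP/(_ p) := etrans (esym ej) ep.
    by rewrite !mnmDE !mnm1E eqxx [k == p]eq_sym (negPf pk) add0n => ->.
  set u := (b_ j' - U_(p))%MM.
  have eu : b_ j' = (U_(p) + u)%MM by rewrite /u addmC submK.
  have et : t = (U_(k) + u)%MM.
    apply: (@addmI _ U_(p)%MM).
    by rewrite -ep ej eu !addmA [(U_(p) + _)%MM]addmC.
  have uO : u \in O by apply: (O_ideal (k := k)); rewrite -et.
  case/term_atP: uO => m em; case/term_atP: (tO) => mt emt.
  rewrite -(@genmx_border p m j') ?em // -(@genmx_border p mt j) ?emt //.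
  rewrite -mul_genmx_delta -(@genmx_O k m mt) ?em ?emt //.
  by rewrite -commutator_col; apply: commutator_entry_neq.
rewrite -(@genmx_border k m j) // -(@genmx_border l m j') //.
by rewrite -commutator_col; apply: commutator_entry_neq; rewrite eq_sym.
Qed.

Lemma I_B_natural_generators f : I_B f <-> in_ideal natural_generator f.
Proof.
split; apply: in_ideal_trans => {}f; last exact: natural_generator_in_I_B.
case=> k l i j kl; rewrite commutator_col.
have nkl : k != l by apply: contraTneq kl => ->; rewrite ltnn.
have swap (u : 'X_{1..n}) : (U_(k) + (U_(l) + u) = U_(l) + (U_(k) + u))%MM.
  by rewrite !addmA [(U_(k) + _)%MM]addmC.
case: (term_step k j) => -[mk ek]; case: (term_step l j) => -[ml el].
- rewrite (genmx_O ek) (genmx_O el) !mul_genmx_delta.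
  case: (term_step k ml) => -[m em].
    have em' : t_ m = (U_(l) + t_ mk)%MM by rewrite em el ek swap.
    by rewrite (genmx_O em) (genmx_O em') subrr mxE; apply: in_ideal0.
  have em' : b_ m = (U_(l) + t_ mk)%MM by rewrite em el ek swap.
  by rewrite (genmx_border em) (genmx_border em') subrr mxE; apply: in_ideal0.
- rewrite (genmx_O ek) (genmx_border el) mul_genmx_delta.
  case: (term_step l mk) => -[m em].
    case/negP: (border_notin ml); apply: (O_ideal (k := k)).
    by rewrite el swap -ek -em; apply/term_atP; exists m.
  rewrite (genmx_border em) -opprB mxE; apply/in_idealN/in_ideal_gen.
  by apply: NextDoor; rewrite em ek el swap.
- rewrite (genmx_border ek) (genmx_O el) mul_genmx_delta.
  case: (term_step k ml) => -[m em].
    case/negP: (border_notin mk); apply: (O_ideal (k := l)).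
    by rewrite ek -swap -el -em; apply/term_atP; exists m.
  rewrite (genmx_border em); apply/in_ideal_gen.
  by apply: NextDoor; rewrite em ek el swap.
- rewrite (genmx_border ek) (genmx_border el).
  by apply/in_ideal_gen; apply: (@AcrossRim l k j) => //; rewrite eq_sym.
Qed.

End BorderBasisScheme.

Arguments C K {n} O.
Arguments genmx K {n} O r.
Arguments commutator_entry {K n} O _.
Arguments I_B {K n} O _.
Arguments natural_generator {K n} O _.

(* Main.v *)
Require Import Defs.
From mathcomp Require Import all_boot all_order all_algebra finmap mpoly zify.

(** The border of a simplicial order ideal consists of terms of degree d + 1
only, so the natural generators to look at are the across-the-rim ones.  Write
c(t,b) for the indeterminate with t in O and b in the border, and let t be
interior.  For k <> l with x_k dividing b, row x_l t of the generator attached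
to the neighbors b and b' = x_l b / x_k is
  c(t,b) - c(x_l t / x_k, b') + quadratic terms,
where the second summand occurs only if x_k divides t, and where every
quadratic term is a product c(x_l t, _) c(u, _) with u of degree d.

It remains to make c(t,b) the largest of these monomials by giving a weight to
every indeterminate.  A weight proportional to d - deg t, which vanishes on the
rim, beats the quadratic terms, because x_l t has one degree more than t.  The
linear tail has the same degree and also the same quotient b / t.  Hence, if k
is chosen as a function of b / t, it is the same index for c(t,b) and for the
tail, while the exponent of x_k drops by one from t to x_l t / x_k; so this
exponent is added to the weight as a small correction.  A suitable k is one
where b has a larger exponent than t: it depends on b / t only, it exists since
deg t < deg b, and x_k then divides b.

The weight and its two inequalities are [cweight], [cweight_shift] and
[cweight_quad]; [wle] refines weighted degree to a term ordering; [LT_wle] and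
[LT_across_rim] read off the leading term.  The numbers of interior and of
border terms come from stars and bars ([card_fset_mdeg]). *)

Set Implicit Arguments.
Unset Strict Implicit.
Unset Printing Implicit Defensive.

Import Order.TTheory GRing.Theory.
Local Notation genmx := Defs.genmx.
Local Open Scope ring_scope.

(** * Term orderings refining a weighted degree *)

Section WeightOrdering.
Context {N : nat} (w : 'I_N -> nat).

Definition wdeg (m : 'X_{1..N}) : nat := (\sum_i m i * w i)%N.

Lemma wdegD m1 m2 : wdeg (m1 + m2)%MM = (wdeg m1 + wdeg m2)%N.
Proof.
by rewrite -big_split; apply: eq_bigr => i _; rewrite mnmDE mulnDl.
Qed.

Lemma wdeg0 : wdeg 0%MM = 0%N.
Proof. by apply: big1 => i _; rewrite mnm0E mul0n. Qed.

Lemma wdeg1 c : wdeg U_(c)%MM = w c.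
Proof.
rewrite /wdeg (bigD1 c) //= mnm1E eqxx mul1n big1 ?addn0 // => i ic.
by rewrite mnm1E eq_sym (negPf ic) mul0n.
Qed.

(** Indeterminates may have weight zero, so the weighted degree alone does not
even make 1 strictly minimal; breaking ties by a genuine term ordering repairs
this, and makes the relation antisymmetric. *)
Definition wle : rel 'X_{1..N} := fun m1 m2 =>
  (wdeg m1 < wdeg m2)%N || (wdeg m1 == wdeg m2) && (m1 <= m2)%O.

Lemma wle_wdeg m1 m2 : wle m1 m2 -> (wdeg m1 <= wdeg m2)%N.
Proof. by case/orP => [/ltnW|/andP [/eqP ->]]. Qed.

Lemma wle_term_ordering : term_ordering wle.
Proof.
split=> [m1 m2|m1 m2|m2 m1 m3|m|m m1 m2]; rewrite /wle.
- by case: (ltngtP (wdeg m1) (wdeg m2)) => //= _; apply: le_total.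
- by case: (ltngtP (wdeg m1) (wdeg m2)) => //= _; apply: le_anti.
- case: ltngtP => //= [lt12 _|-> le12].
    by case/orP => [/(ltn_trans lt12) ->|/andP [/eqP <-]]; rewrite ?lt12.
  case/orP => [->//|/andP [-> le23]].
  by rewrite (le_trans le12 le23) orbT.
- by rewrite wdeg0 le0m andbT; case: (wdeg m).
- by rewrite !wdegD ltn_add2l eqn_add2l lemc_add2r.
Qed.

Section Below.
Context {R : comNzRingType} (W : nat).
Implicit Types p q : {mpoly R[N]}.

(** Stated through coefficients rather than through the support, so that it is
visibly stable under linear operations. *)
Definition below p : Prop := forall m, (W <= wdeg m)%N -> p@_m = 0.

Lemma below0 : below 0.
Proof. by move=> m _; rewrite mcoeff0. Qed.

Lemma belowD p q : below p -> below q -> below (p + q).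
Proof. by move=> bp bq m Wm; rewrite mcoeffD bp ?bq ?addr0. Qed.

Lemma belowN p : below p -> below (- p).
Proof. by move=> bp m Wm; rewrite mcoeffN bp ?oppr0. Qed.

Lemma below_monomial m : (wdeg m < W)%N -> below 'X_[m].
Proof.
move=> mW u Wu; rewrite mcoeffX; case: eqP => // emu.
by move: mW; rewrite emu ltnNge Wu.
Qed.

End Below.

(** A single indeterminate dominates any polynomial of smaller weight, whatever
breaks the ties between monomials of equal weight. *)
Lemma LT_wle (R : comNzRingType) c (p : {mpoly R[N]}) :
  below (w c) p -> LT wle ('X_c + p) = U_(c)%MM.
Proof.
move=> bp; set f := 'X_c + p.
have fc : f@_U_(c) = 1 by rewrite mcoeffD mcoeffX eqxx bp ?addr0 // wdeg1.
have f0 : f != 0.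
  apply: contraTneq isT => f0; move: fc.
  by rewrite f0 mcoeff0 => /esym/eqP; rewrite oner_eq0.
have [Lin Lmax] := LTP wle_term_ordering f0.
have cf : U_(c)%MM \in msupp f by rewrite mcoeff_msupp fc oner_neq0.
(* The leading monomial weighs at least as much as c, where p has no support. *)
have /wle_wdeg := Lmax _ cf; rewrite wdeg1 => cL.
move: Lin; rewrite mcoeff_msupp mcoeffD (bp _ cL) addr0 mcoeffX.
by case: (U_(c)%MM =P _) => // _; rewrite eqxx.
Qed.

End WeightOrdering.

(** * Leading terms of across-the-rim generators *)

Section AcrossRimLT.
Context {K : fieldType} {n : nat} {O : {fset 'X_{1..n}}}.
Local Notation mu := #|` O|.
Local Notation nu := #|` border O|.
Local Notation t_ := (term_at O).
Local Notation b_ := (term_at (border O)).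
Context (w : 'I_(mu * nu) -> nat).

(** In the product of row i of a multiplication matrix with column j of C, the
summand for t_m is an indeterminate, zero, or a product of two indeterminates,
according to whether x_k t_m is t_i, another term of O, or a border term.  The
predicate P leaves room for taking the future leading term out of the sum. *)
Lemma below_row_col (W : nat) (P : pred 'I_mu) (k : 'I_n) (i : 'I_mu)
    (j : 'I_nu) :
  (forall m, P m -> t_ i = (U_(k) + t_ m)%MM -> (w (mxvec_index m j) < W)%N) ->
  (forall m j2, b_ j2 = (U_(k) + t_ m)%MM ->
     (w (mxvec_index i j2) + w (mxvec_index m j) < W)%N) ->
  below w W (\sum_(m | P m) genmx K O k i m * C K O m j).
Proof.
move=> lin quad; elim/big_rec: _ => [|m p Pm bp]; first exact: below0.
apply: belowD => // {p bp}; rewrite /Defs.genmx /C !mxE.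
case: pickP => [m' /eqP em|_].
  case: eqP => [eim|_]; last by rewrite mul0r; apply: below0.
  by rewrite mul1r; apply: below_monomial; rewrite wdeg1 lin // eim.
case: pickP => [j2 /eqP ej|_]; last by rewrite mul0r; apply: below0.
rewrite mxE -mpolyXD; apply: below_monomial.
by rewrite wdegD !wdeg1 quad.
Qed.

(** The row is the one of t_i = x_l t_(m0), as this is where column m0 of the
l-th multiplication matrix has its entry 1, which isolates the indeterminate
of index (m0, j).  The hypotheses bound the linear tail and the quadratic
terms. *)
Lemma LT_across_rim (k l : 'I_n) (i m0 : 'I_mu) (j j' : 'I_nu) :
  t_ i = (U_(l) + t_ m0)%MM ->
  (forall m, t_ i = (U_(k) + t_ m)%MM ->
     (w (mxvec_index m j') < w (mxvec_index m0 j))%N) ->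
  (forall r m j1 j2, b_ j2 = (U_(r) + t_ m)%MM ->
     (w (mxvec_index i j2) + w (mxvec_index m j1)
      < w (mxvec_index m0 j))%N) ->
  LT (wle w)
     ((genmx K O l *m col j (C K O) - genmx K O k *m col j' (C K O)) i 0)
    = U_(mxvec_index m0 j)%MM.
Proof.
move=> ei lin quad.
have entry r s : (genmx K O r *m col s (C K O)) i 0
    = \sum_m genmx K O r i m * C K O m s.
  by rewrite mxE; apply: eq_bigr => m _; rewrite [col _ _ _ _]mxE.
rewrite [X in LT _ X]mxE [X in LT _ (_ + X)]mxE !entry (bigD1 m0) //=.
have -> : genmx K O l i m0 = 1.
  by have /colP/(_ i) := genmx_O K ei; rewrite !mxE !eqxx.
rewrite mul1r [C _ _ m0 j]mxE -addrA; apply: LT_wle; apply: belowD.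
  apply: below_row_col => [m m0m em|m j2 /quad]; last exact.
  case/eqP: m0m; apply: (@term_at_inj n O).
  by apply: (@addmI _ U_(l)%MM); rewrite -ei.
by apply/belowN/below_row_col => [m _ /lin|m j2 /quad]; apply.
Qed.

End AcrossRimLT.

(** * The weight of an indeterminate *)

Section CWeight.
Context {n : nat} (d : nat).
Implicit Types t u b : 'X_{1..n}.

(** The choice depends on the quotient b / t only, so that it is unchanged when
t and b are multiplied or divided by the same indeterminates. *)
Definition excess_var t b : option 'I_n := [pick k | (t k < b k)%N].

(** The correction is at most d, for each factor of a quadratic term; the factor
2 d + 1 therefore lets one degree outweigh two corrections. *)
Definition cweight t b : nat :=
  ((d - mdeg t) * d.*2.+1
   + (if excess_var t b is Some k then t k else 0))%N.

Lemma mnm_le_mdeg t k : (t k <= mdeg t)%N.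
Proof. by rewrite mdegE (bigD1 k) //= leq_addr. Qed.

Lemma cweight_le t b : (mdeg t <= d)%N ->
  (cweight t b <= (d - mdeg t) * d.*2.+1 + d)%N.
Proof.
move=> td; rewrite leq_add2l; case: (excess_var t b) => // k.
exact: leq_trans (mnm_le_mdeg t k) td.
Qed.

Lemma excess_varP t b : (mdeg t < mdeg b)%N ->
  exists2 k, excess_var t b = Some k & (t k < b k)%N.
Proof.
rewrite /excess_var; case: pickP => [k tb _|le_bt]; first by exists k.
rewrite ltnNge !mdegE leq_sum // => i _.
by rewrite leqNgt le_bt.
Qed.

(** Bound for the linear tail, where t' = x_l t / x_k and b' = x_l b / x_k: the
degree and the chosen index k are those of t and b, and only the exponent of
x_k changes. *)
Lemma cweight_shift k l t b t' b' :
  excess_var t b = Some k -> k != l ->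
  (U_(l) + t = U_(k) + t')%MM -> (U_(l) + b = U_(k) + b')%MM ->
  (cweight t' b' < cweight t b)%N.
Proof.
move=> ek kl et eb.
have et_ i : ((l == i) + t i = (k == i) + t' i)%N.
  by have /mnmP/(_ i) := et; rewrite !mnmDE !mnm1E.
have eb_ i : ((l == i) + b i = (k == i) + b' i)%N.
  by have /mnmP/(_ i) := eb; rewrite !mnmDE !mnm1E.
have -> : cweight t' b' = ((d - mdeg t) * d.*2.+1 + t' k)%N.
  rewrite /cweight; have -> : mdeg t' = mdeg t.
    by have /(congr1 mdeg) := et; rewrite !mdegD !mdeg1 => -[].
  suff -> : excess_var t' b' = Some k by [].
  rewrite -ek; apply: eq_pick => i /=.
  by have := et_ i; have := eb_ i; lia.
rewrite /cweight ek ltn_add2l.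
by have := et_ k; rewrite eqxx eq_sym (negPf kl); lia.
Qed.

(** Bound for the quadratic terms: u lies on the rim, so its weight is only a
correction, and x_l t gains one degree over t. *)
Lemma cweight_quad l t u b b1 b2 :
  (mdeg t < d)%N -> mdeg u = d ->
  (cweight (U_(l) + t)%MM b2 + cweight u b1 < cweight t b)%N.
Proof.
move=> td ud.
have le1 : (mdeg (U_(l) + t)%MM <= d)%N by rewrite mdegD mdeg1.
have := cweight_le b2 le1; have := cweight_le b1 (eq_leq ud).
have : ((d - mdeg t) * d.*2.+1 <= cweight t b)%N by apply: leq_addr.
rewrite ud subnn mdegD mdeg1.
have -> : (d - mdeg t = (d - (1 + mdeg t)).+1)%N by lia.
by rewrite mulSn; lia.
Qed.

(** Two indeterminates are needed to cross the rim: for n = 1 there is no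
choice of l. *)
Lemma excess_var_neighbor t b : (2 <= n)%N -> (mdeg t < mdeg b)%N ->
  exists (k l : 'I_n) (u : 'X_{1..n}),
    [/\ excess_var t b = Some k, k != l & b = (U_(k) + u)%MM].
Proof.
move=> n2 /excess_varP [k ek tbk].
have [l kl] : exists l, k != l.
  have [/eqP k0|k0] := boolP (k == Ordinal (ltnW n2)).
    by exists (Ordinal n2); rewrite k0.
  by exists (Ordinal (ltnW n2)).
exists k, l, (b - U_(k))%MM; split=> //.
by rewrite addmC submK // lep1mP -lt0n; apply: leq_ltn_trans tbk.
Qed.

End CWeight.

(** * Border and interior of the simplicial order ideal *)

Section Simplicial.
Context {n : nat} (d : nat).
Local Notation O := (simplicial n d).

Lemma mem_border_simplicial b : (0 < n)%N ->
  (b \in border O) = (mdeg b == d.+1).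
Proof.
move=> n0; apply/in_border/eqP => [[bO [k [t tO eb]]]|eb].
  move: bO tO; rewrite eb !in_simplicial mdegD mdeg1 add1n -ltnNge => dt td.
  by apply/eqP; rewrite eqSS eqn_leq td.
rewrite in_simplicial eb ltnn; split=> //.
have [k bk] : exists k, (0 < b k)%N.
  have /existsP// : [exists k, (0 < b k)%N].
  rewrite -[[exists _, _]]negbK negb_exists; apply/negP => /forallP b0.
  move: eb; rewrite mdegE big1 // => i _.
  by move: (b0 i); rewrite lt0n negbK => /eqP.
have Uk : (U_(k) <= b)%MM by rewrite lep1mP -lt0n.
exists k, (b - U_(k))%MM; last by rewrite addmC submK.
have /(congr1 mdeg) := submK Uk.
by rewrite in_simplicial mdegD mdeg1 eb addn1 => -[->].
Qed.

Lemma mem_interior_simplicial t : (0 < n)%N ->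
  (t \in interior O) = (mdeg t < d)%N.
Proof.
move=> n0; rewrite /interior /rim inE /= !inE /= in_simplicial.
under eq_existsb => k do rewrite mem_border_simplicial // mdegD mdeg1 eqSS.
have -> : [exists k : 'I_n, mdeg t == d] = (mdeg t == d).
  by apply/existsP/idP => [[]//|]; exists (Ordinal n0).
by case: ltngtP.
Qed.

End Simplicial.

(** * Counting interior terms, border terms and interior indeterminates *)

Section Counting.
Context {n : nat}.

(** Exponent vectors of degree at most D have all exponents at most D, hence
are tuples over a finite type, for which the partitions of an integer into
ordered parts have been counted. *)
Lemma card_fset_mdeg (A : {fset 'X_{1..n}}) (P : pred nat) (D : nat) :
  (forall e, P e -> (e <= D)%N) -> (forall t, (t \in A) = P (mdeg t)) ->
  #|` A| = #|[set s : n.-tuple 'I_D.+1 | P (\sum_(i <- s) i)%N]|.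
Proof.
move=> PD AP; pose S := [set s : n.-tuple 'I_D.+1 | P (\sum_(i <- s) i)%N].
pose f (s : n.-tuple 'I_D.+1) : 'X_{1..n} := [multinom (tnth s i : nat) | i < n].
have mdegf s : mdeg (f s) = (\sum_(i <- s) i)%N.
  by rewrite mdegE big_tuple; apply: eq_bigr => i _; rewrite mnmE.
have finj : injective f.
  move=> s1 s2 /mnmP e; apply: eq_from_tnth => i; apply: val_inj.
  by have := e i; rewrite !mnmE.
have -> : A = [fset f s | s in S]%fset.
  apply/fsetP => t; rewrite AP; apply/idP/imfsetP => [Pt|[s /= sS ->]].
    have tD i : (t i < D.+1)%N.
      by rewrite ltnS (leq_trans (mnm_le_mdeg t i)) ?PD.
    have tf : t = f [tuple inord (t i) | i < n].
      by apply/mnmP => i; rewrite mnmE tnth_mktuple inordK.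
    by exists [tuple inord (t i) | i < n]; rewrite //= inE -mdegf -tf.
  by move: sS; rewrite inE mdegf.
by rewrite card_imfset //= -cardE.
Qed.

Lemma card_simplicial_interior d : (0 < n)%N -> (0 < d)%N ->
  #|` interior (simplicial n d)| = 'C(d + n - 1, n).
Proof.
case: d => // d n0 _.
rewrite (@card_fset_mdeg _ (fun e => e <= d)%N d) // => [|t].
  by rewrite card_partial_ord_partitions addSn subn1 addnC.
by rewrite mem_interior_simplicial.
Qed.

Lemma card_simplicial_border d : (0 < n)%N ->
  #|` border (simplicial n d)| = 'C(d + n, n - 1).
Proof.
move=> n0.
rewrite (@card_fset_mdeg _ (fun e => e == d.+1) d.+1) => [|e /eqP ->|t] //.
  case: n n0 => // n' _.
  by rewrite card_ord_partitions subn1 addnC addSnnS.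
exact: mem_border_simplicial.
Qed.

Lemma mxvec_index_inj (m p : nat) : injective (uncurry (@mxvec_index m p)).
Proof. by move=> [i1 j1] [i2 j2] /= /cast_ord_inj /enum_rank_inj. Qed.

(** The enumeration of the c_ij by mxvec_index is injective, so rewriting C_int
as an image of a product of sets makes its cardinality a product. *)
Lemma C_int_imset (O : {fset 'X_{1..n}}) :
  C_int O = [set uncurry (@mxvec_index _ _) p
            | p in setX [set i | term_at O i \in interior O]
                        [set: 'I_#|` border O|]].
Proof.
apply/setP => c; apply/imset2P/imsetP => [[i j ii _ ->]|[[i j]]].
  by exists (i, j); rewrite // in_setX in_setT andbT in_set.
by rewrite in_setX in_setT andbT in_set => /= ii ->; exists i j.
Qed.

Lemma card_C_int (O : {fset 'X_{1..n}}) :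
  #|C_int O| = (#|` interior O| * #|` border O|)%N.
Proof.
rewrite C_int_imset card_imset; last exact: mxvec_index_inj.
rewrite cardsX cardsT card_ord; congr (_ * _)%N.
set S := [set i | _].
have -> : interior O = [fset term_at O i | i in S]%fset.
  apply/fsetP => t; apply/idP/imfsetP => [ti|[i /= iS ->]]; last first.
    by move: iS; rewrite in_set.
  have tO : t \in O by move: ti; rewrite inE => /andP [].
  by have /term_atP [i et] := tO; exists i; rewrite //= in_set et.
by rewrite card_imfset /= -?cardE //; apply: term_at_inj.
Qed.

End Counting.

(** * Separating interior indeterminates *)

Theorem proposition5p4 (K : fieldType) (n d : nat) (hn : (2 <= n)%N)
    (hd : (1 <= d)%N) :
  let O := simplicial n d in
  let N := (#|` O| * #|` border O|)%N in
  let Z := enum_tuple (C_int O) in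
  [/\ #|C_int O| = (#|` interior O| * #|` border O|)%N,
      (#|` interior O| * #|` border O|)%N
        = ('C(d + n - 1, n) * 'C(d + n, n - 1))%N
    & exists2 sigma : rel 'X_{1..N}, term_ordering sigma
      & exists f : 'I_N -> {mpoly K[N]},
          (* (a) *)
          (forall c : 'I_N, c \in C_int O ->
             natural_generator O (f c) /\ LT sigma (f c) = U_(c)%MM) /\
          (* (b) *)
          (let F := map_tuple f Z in
           separating Z F /\ forall g, g \in F -> natural_generator O g)].
Proof.
move=> O N Z.
have n0 : (0 < n)%N := ltnW hn.
split; first exact: card_C_int.
  by rewrite card_simplicial_interior // card_simplicial_border.
pose w (c : 'I_N) : nat :=
  mxvec (\matrix_(i, j) cweight d (term_at O i) (term_at (border O) j)) 0 c.
have wE i j : w (mxvec_index i j)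
    = cweight d (term_at O i) (term_at (border O) j).
  by rewrite /w mxvecE mxE.
have bordE j : mdeg (term_at (border O) j) = d.+1.
  apply/eqP; rewrite -mem_border_simplicial //; apply/term_atP; by exists j.
exists (wle w); first exact: wle_term_ordering.
have /fin_all_exists [f fP] (c : 'I_N) : exists g : {mpoly K[N]},
    c \in C_int O -> natural_generator O g /\ LT (wle w) g = U_(c)%MM.
  case/mxvec_indexP: c => m0 j.
  have [|_] := boolP (_ \in _); last by exists 0.
  case/imset2P => m1 j1 im1 _ e.
  move: im1; have [<- _] : (m0, j) = (m1, j1) by apply: mxvec_index_inj.
  move=> im0; have m0d : (mdeg (term_at O m0) < d)%N.
    by rewrite -mem_interior_simplicial.
  have m0b : (mdeg (term_at O m0) < mdeg (term_at (border O) j))%N.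
    by rewrite bordE ltnW.
  (* Here u = b / x_k is the rim term whose multiples by x_k and x_l are the
     two neighbors. *)
  have [k [l [u [ek kl bu]]]] := excess_var_neighbor hn m0b.
  have ud : mdeg u = d.
    by have := bordE j; rewrite bu mdegD mdeg1 => -[].
  have [m em] : exists m, term_at O m = u.
    by apply/term_atP; rewrite in_simplicial ud.
  have [i ei] : exists i, term_at O i = (U_(l) + term_at O m0)%MM.
    by apply/term_atP; rewrite in_simplicial mdegD mdeg1.
  have [j' ej'] : exists j', term_at (border O) j' = (U_(l) + u)%MM.
    by apply/term_atP; rewrite mem_border_simplicial // mdegD mdeg1 ud.
  exists ((genmx K O l *m col j (C K O) - genmx K O k *m col j' (C K O)) i 0).
  move=> _; split; first by apply: (@AcrossRim _ _ _ k l m); rewrite ?em.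
  apply: LT_across_rim => // [m' em'|r m' j1' j2 ej2]; rewrite !wE.
    apply: (cweight_shift d ek kl); first by rewrite -ei.
    by rewrite ej' bu !addmA [(U_(l) + _)%MM]addmC.
  rewrite ei; apply: cweight_quad => //.
  by have := bordE j2; rewrite ej2 mdegD mdeg1 => -[].
exists f; split=> [c /fP //|F]; split.
  split; first exact: enum_uniq.
  exists (wle w); first exact: wle_term_ordering.
  move=> k; rewrite tnth_map.
  have /fP[] // : tnth Z k \in C_int O by rewrite -mem_enum mem_tnth.
by move=> g /mapP [c]; rewrite mem_enum => /fP [gP _] ->.
Qed.
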